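(* Let $F_2$ be the free group of rank $2$ with a fixed free basis. For every $\Phi\in\mathrm{Out}(F_2)$, $\|\Phi^{-1}\|_1=\|\Phi\|_1$. Consequently, $\beta_2(n)=n$.
   Context: Let $a,b$ be the fixed free basis of $F_2$. For $w\in F_2$, $|w|$ is the length of the reduced word in $a^{\pm1},b^{\pm1}$ representing $w$. Automorphisms act on the right. For $\varphi\in \mathrm{Aut}(F_2)$ put $\|\varphi\|_1=|a\varphi|+|b\varphi|$. For $g\in F_2$ let $\lambda_g$ be the inner automorphism $x\mapsto g^{-1}xg$, let $\Lambda=\{\lambda_g\mid g\in F_2\}$ and $\mathrm{Out}(F_2)=\mathrm{Aut}(F_2)/\Lambda$, whose elements are the cosets $\varphi\Lambda$. For $\Phi\in\mathrm{Out}(F_2)$ put $\|\Phi\|_1=\min\{\|\varphi\|_1 \mid \varphi\in\Phi\}$. For $n\in\mathbb{N}=\{0,1,2,\dots\}$ define $\beta_2(n)=\max\{\|\Phi^{-1}\|_1 \mid \Phi\in\mathrm{Out}(F_2),\ \|\Phi\|_1\leqslant n\}$, with the convention $\max\emptyset=0$.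
   Formalization: The equality β₂(n) = n is stated for every n ≠ 1: since every Φ has ‖Φ‖₁ ≥ 2, the set for n = 1 is empty and β₂(1) = max ∅ = 0, so the claim fails exactly there. *)

(* Defs.v *)
From HB Require Import structures.
From mathcomp Require Import all_boot.
From mathcomp Require Import boolp classical_sets.

Set Implicit Arguments.
Unset Strict Implicit.
Unset Printing Implicit Defensive.

Local Open Scope group_scope.
Local Open Scope classical_set_scope.

(* A letter [(x, false)] is the generator x, [(x, true)] its formal inverse.  *)
Section FreeGroup.
Variable X : choiceType.

Definition letter : Type := (X * bool)%type.
HB.instance Definition _ := Choice.on letter.

Definition inv_letter (l : letter) : letter := (l.1, ~~ l.2).

Definition reduced (w : seq letter) : bool :=
  sorted (fun l m => m != inv_letter l) w.

Record free_group := FreeGroup { fg_word : seq letter; _ : reduced fg_word }.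
HB.instance Definition _ := [isSub for fg_word].
HB.instance Definition _ := [Choice of free_group by <:].

Definition fg_push (l : letter) (w : seq letter) : seq letter :=
  if w is m :: t then (if m == inv_letter l then t else l :: w) else [:: l].

(* The reduced form of the concatenation [u ++ v] when [v] is reduced.        *)
Definition fg_cat (u v : seq letter) : seq letter := foldr fg_push v u.

Definition fg_invw (w : seq letter) : seq letter := rev (map inv_letter w).

Lemma inv_letterK : involutive inv_letter.
Proof. by case=> x b; rewrite /inv_letter /= negbK. Qed.

Lemma reduced_push l w : reduced w -> reduced (fg_push l w).
Proof.
case: w => [|m t] //= rw; case: ifPn => [_|Hm]; last by rewrite /= Hm.
exact: path_sorted rw.
Qed.

Lemma reduced_cat u v : reduced v -> reduced (fg_cat u v).
Proof. by move=> rv; elim: u => [|l u IH] //=; apply: reduced_push. Qed.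

Lemma fg_pushK l w : reduced w -> fg_push l (fg_push (inv_letter l) w) = w.
Proof.
case: w => [|m t] /=; first by rewrite eqxx.
rewrite inv_letterK; case: eqP => [->|_ _] /=; last by rewrite eqxx.
by case: t => [|n t] //= /andP[/negbTE ->].
Qed.

Lemma fg_cat_push l v w : reduced w ->
  fg_cat (fg_push l v) w = fg_push l (fg_cat v w).
Proof.
move=> rw; case: v => [|m t] //=; case: eqP => [->|//].
by rewrite fg_pushK // reduced_cat.
Qed.

Lemma fg_catA u v w : reduced w -> fg_cat u (fg_cat v w) = fg_cat (fg_cat u v) w.
Proof. by move=> rw; elim: u => [|l u IH] //=; rewrite IH fg_cat_push. Qed.

Lemma fg_cat0 w : reduced w -> fg_cat w [::] = w.
Proof.
elim: w => [|l w IH] //= rw; rewrite IH; last exact: path_sorted rw.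
by case: w rw {IH} => [|m t] //= /andP[/negbTE ->].
Qed.

Lemma fg_catV w : fg_cat (fg_invw w) w = [::].
Proof.
elim: w => [|l w IH] //; rewrite /fg_invw /= rev_cons /fg_cat foldr_rcons /=.
by rewrite inv_letterK eqxx.
Qed.

Lemma fg_invwK : involutive fg_invw.
Proof. by move=> w; rewrite /fg_invw map_rev revK mapK //; apply: inv_letterK. Qed.

Lemma reduced_inv w : reduced w -> reduced (fg_invw w).
Proof.
rewrite /reduced /fg_invw rev_sorted sorted_map; apply: sub_sorted => l m /=.
by apply: contra => /eqP ->; rewrite inv_letterK.
Qed.

Definition fg_mul (u v : free_group) : free_group :=
  FreeGroup (reduced_cat (fg_word u) (valP v)).
Definition fg_inv (u : free_group) : free_group :=
  FreeGroup (reduced_inv (valP u)).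
Definition fg_one : free_group := @FreeGroup [::] isT.

Lemma fg_mulA : associative fg_mul.
Proof. by move=> u v w; apply: val_inj; rewrite /= fg_catA //; apply: valP w. Qed.
Lemma fg_mul1 : left_id fg_one fg_mul.
Proof. by move=> u; apply: val_inj. Qed.
Lemma fg_mulr1 : right_id fg_one fg_mul.
Proof. by move=> u; apply: val_inj; rewrite /= fg_cat0 //; apply: valP u. Qed.
Lemma fg_mulV : left_inverse fg_one fg_inv fg_mul.
Proof. by move=> u; apply: val_inj; rewrite /= fg_catV. Qed.
Lemma fg_mulrV : right_inverse fg_one fg_inv fg_mul.
Proof.
move=> u; apply: val_inj => /=.
by rewrite -{1}[fg_word u]fg_invwK fg_catV.
Qed.

HB.instance Definition _ :=
  isGroup.Build free_group fg_mulA fg_mul1 fg_mulr1 fg_mulV fg_mulrV.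

Definition fg_gen (x : X) : free_group := @FreeGroup [:: (x, false)] isT.

Definition fg_length (w : free_group) : nat := size (fg_word w).

End FreeGroup.

Section Automorphisms.
Variable G : groupType.

Record Aut := MkAut {
  aut_fun :> {multiplicative G -> G};
  aut_bij : bijective aut_fun }.

HB.instance Definition _ := gen_eqMixin Aut.
HB.instance Definition _ := gen_choiceMixin Aut.

Lemma aut_ext (phi psi : Aut) : phi =1 psi -> phi = psi.
Proof.
case: phi psi => [[f [[cf]]] bf] [[g [[cg]]] bg] /= /funext efg.
by subst g; rewrite (Prop_irrelevance cg cf) in bg *; rewrite (Prop_irrelevance bg bf).
Qed.

Definition mk_aut (f g : G -> G) (fM : {morph f : x y / x * y})
    (fK : cancel f g) (gK : cancel g f) : Aut :=
  @MkAut (HB.pack_for {multiplicative G -> G} f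
            (isMultiplicative.Build _ _ f fM)) (Bijective fK gK).

Definition aut_inv_fun (phi : Aut) : G -> G :=
  let: exist g _ := cid (let: Bijective g fK gK := aut_bij phi in
    ex_intro (fun g => cancel phi g /\ cancel g phi) g (conj fK gK)) in g.

Lemma aut_invP (phi : Aut) :
  cancel phi (aut_inv_fun phi) /\ cancel (aut_inv_fun phi) phi.
Proof. by rewrite /aut_inv_fun; case: cid. Qed.

Lemma aut_inv_morph (phi : Aut) : {morph aut_inv_fun phi : x y / x * y}.
Proof. by have [fK gK] := aut_invP phi; apply: can2_gmulfM fK gK. Qed.

Lemma aut_comp_morph (phi psi : Aut) :
  {morph (fun x => psi (phi x)) : x y / x * y}.
Proof. by move=> x y; rewrite !gmulfM. Qed.

Lemma aut_comp_K (phi psi : Aut) : cancel (fun x => psi (phi x))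
  (fun x => aut_inv_fun phi (aut_inv_fun psi x)).
Proof. by move=> x; rewrite (aut_invP psi).1 (aut_invP phi).1. Qed.

Lemma aut_comp_Kr (phi psi : Aut) :
  cancel (fun x => aut_inv_fun phi (aut_inv_fun psi x))
    (fun x => psi (phi x)).
Proof. by move=> x; rewrite (aut_invP phi).2 (aut_invP psi).2. Qed.

Lemma aut_id_morph : {morph @id G : x y / x * y}. Proof. by []. Qed.
Lemma aut_id_K : cancel (@id G) id. Proof. by []. Qed.

(* Automorphisms act on the right: [phi * psi] applies [phi] first.           *)
Definition aut_mul (phi psi : Aut) : Aut :=
  mk_aut (aut_comp_morph phi psi) (aut_comp_K phi psi) (aut_comp_Kr phi psi).
Definition aut_one : Aut := mk_aut aut_id_morph aut_id_K aut_id_K.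
Definition aut_inv (phi : Aut) : Aut :=
  mk_aut (@aut_inv_morph phi) (aut_invP phi).2 (aut_invP phi).1.

Lemma aut_mulA : associative aut_mul.
Proof. by move=> f g h; apply: aut_ext. Qed.
Lemma aut_mul1 : left_id aut_one aut_mul.
Proof. by move=> f; apply: aut_ext. Qed.
Lemma aut_mulr1 : right_id aut_one aut_mul.
Proof. by move=> f; apply: aut_ext. Qed.
Lemma aut_mulV : left_inverse aut_one aut_inv aut_mul.
Proof. by move=> f; apply: aut_ext => x /=; apply: (aut_invP f).2. Qed.
Lemma aut_mulrV : right_inverse aut_one aut_inv aut_mul.
Proof. by move=> f; apply: aut_ext => x /=; apply: (aut_invP f).1. Qed.

HB.instance Definition _ :=
  isGroup.Build Aut aut_mulA aut_mul1 aut_mulr1 aut_mulV aut_mulrV.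

Lemma inner_morph (g : G) : {morph (fun x => x ^ g) : x y / x * y}.
Proof. by move=> x y; rewrite conjMg. Qed.
Lemma inner_K (g : G) : cancel (fun x => x ^ g) (fun x => x ^ g^-1).
Proof. by move=> x; rewrite conjgK. Qed.
Lemma inner_Kr (g : G) : cancel (fun x => x ^ g^-1) (fun x => x ^ g).
Proof. by move=> x; rewrite conjgKV. Qed.

(* [x ^ g] is [g^-1 * (x * g)].                                               *)
Definition inner (g : G) : Aut :=
  mk_aut (inner_morph g) (@inner_K g) (@inner_Kr g).

Definition Inn : set Aut := range inner.

Definition inn_coset (phi : Aut) : set Aut := [set phi * l | l in Inn].

Record Out := MkOut {
  out_set : set Aut;
  out_setP : exists phi, out_set = inn_coset phi }.

HB.instance Definition _ := gen_eqMixin Out.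
HB.instance Definition _ := gen_choiceMixin Out.

Lemma out_ext (P Q : Out) : out_set P = out_set Q -> P = Q.
Proof.
by case: P Q => [A hA] [B hB] /= e; subst B; rewrite (Prop_irrelevance hA hB).
Qed.

Lemma innerM g h : inner g * inner h = inner (g * h).
Proof. by apply: aut_ext => x /=; rewrite conjgM. Qed.
Lemma inner1 : inner 1 = 1.
Proof. by apply: aut_ext => x /=; rewrite conjg1. Qed.
Lemma innerV g : (inner g)^-1 = inner g^-1.
Proof. by apply: (@mulgI _ (inner g)); rewrite mulgV innerM mulgV inner1. Qed.
Lemma autV (phi : Aut) g : phi g^-1 = (phi g)^-1.
Proof.
by apply: (@mulgI _ (phi g)); rewrite -gmulfM !mulgV; apply: (@mulgI _ (phi 1));
   rewrite -gmulfM !mulg1.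
Qed.
Lemma inner_comm (phi : Aut) g : inner g * phi = phi * inner (phi g).
Proof. by apply: aut_ext => x /=; rewrite /conjg !gmulfM autV. Qed.

Lemma inn_cosetP phi psi :
  inn_coset phi psi <-> exists g, psi = phi * inner g.
Proof.
by split=> [[_ [g _ <-] <-]|[g ->]]; [exists g | exists (inner g) => //; exists g].
Qed.

Lemma inn_cosetM phi psi :
  [set f * g | f in inn_coset phi & g in inn_coset psi] = inn_coset (phi * psi).
Proof.
apply/seteqP; split=> [_ [_ /inn_cosetP[g ->] [_ /inn_cosetP[h ->] <-]]|].
  apply/inn_cosetP; exists (psi g * h).
  by rewrite -innerM !mulgA -(mulgA phi (inner g)) inner_comm !mulgA.
move=> _ /inn_cosetP[g ->]; exists phi.
  by apply/inn_cosetP; exists 1; rewrite inner1 mulg1.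
by exists (psi * inner g); [apply/inn_cosetP; exists g | rewrite mulgA].
Qed.

Lemma inn_cosetV phi :
  [set f^-1 | f in inn_coset phi] = inn_coset phi^-1.
Proof.
apply/seteqP; split=> [_ [_ /inn_cosetP[g ->] <-]|_ /inn_cosetP[g ->]].
  by apply/inn_cosetP; exists (phi^-1 g^-1); rewrite invgM innerV inner_comm.
exists (phi * inner (phi g^-1)); first by apply/inn_cosetP; eexists.
by rewrite -inner_comm invgM -innerV invgK.
Qed.

Lemma out_mul_proof (P Q : Out) : exists phi,
  [set f * g | f in out_set P & g in out_set Q] = inn_coset phi.
Proof.
have [f ->] := out_setP P; have [g ->] := out_setP Q.
by exists (f * g); rewrite inn_cosetM.
Qed.

Lemma out_inv_proof (P : Out) : exists phi,
  [set f^-1 | f in out_set P] = inn_coset phi.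
Proof. by have [f ->] := out_setP P; exists f^-1; rewrite inn_cosetV. Qed.

Definition out_class (phi : Aut) : Out :=
  MkOut (ex_intro (fun f => inn_coset phi = inn_coset f) phi erefl).
Definition out_mul (P Q : Out) : Out := MkOut (out_mul_proof P Q).
Definition out_inv (P : Out) : Out := MkOut (out_inv_proof P).
Definition out_one : Out := out_class 1.

Lemma out_classM f g : out_mul (out_class f) (out_class g) = out_class (f * g).
Proof. by apply: out_ext; rewrite /= inn_cosetM. Qed.
Lemma out_classV f : out_inv (out_class f) = out_class f^-1.
Proof. by apply: out_ext; rewrite /= inn_cosetV. Qed.
Lemma out_classP (P : Out) : exists phi, P = out_class phi.
Proof. by case: (out_setP P) => f e; exists f; apply: out_ext. Qed.

Lemma out_mulA : associative out_mul.
Proof.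
move=> P Q S; have [f ->] := out_classP P; have [g ->] := out_classP Q.
by have [h ->] := out_classP S; rewrite !out_classM mulgA.
Qed.
Lemma out_mul1 : left_id out_one out_mul.
Proof. by move=> P; have [f ->] := out_classP P; rewrite out_classM mul1g. Qed.
Lemma out_mulr1 : right_id out_one out_mul.
Proof. by move=> P; have [f ->] := out_classP P; rewrite out_classM mulg1. Qed.
Lemma out_mulV : left_inverse out_one out_inv out_mul.
Proof.
by move=> P; have [f ->] := out_classP P; rewrite out_classV out_classM mulVg.
Qed.
Lemma out_mulrV : right_inverse out_one out_inv out_mul.
Proof.
by move=> P; have [f ->] := out_classP P; rewrite out_classV out_classM mulgV.
Qed.

HB.instance Definition _ :=
  isGroup.Build Out out_mulA out_mul1 out_mulr1 out_mulV out_mulrV.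

End Automorphisms.

Definition F2 : groupType := free_group 'I_2.
Definition gen_a : F2 := fg_gen (ord0 : 'I_2).
Definition gen_b : F2 := fg_gen (ord_max : 'I_2).

(* Both are 0 when no minimum (resp. maximum) exists.                         *)
Definition set_min (A : set nat) : nat :=
  xget 0 [set m | A m /\ forall k, A k -> m <= k].
Definition set_max (A : set nat) : nat :=
  xget 0 [set m | A m /\ forall k, A k -> k <= m].

Definition aut_norm (phi : Aut F2) : nat :=
  fg_length (phi gen_a) + fg_length (phi gen_b).

Definition out_norm (Phi : Out F2) : nat :=
  set_min [set aut_norm phi | phi in out_set Phi].

Definition beta2 (n : nat) : nat :=
  set_max [set out_norm Phi^-1 | Phi in [set Phi : Out F2 | out_norm Phi <= n]].

(* Main.v *)
Require Import Defs.
From mathcomp Require Import all_boot all_algebra zify ring.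
From mathcomp Require Import boolp classical_sets.

(** Let [M] be the integer 2 x 2 matrix by which an automorphism [phi] of F2
    acts on the abelianization.  The point is that the norm of the outer class
    of [phi] is the sum of the absolute values of the entries of [M]
    ([out_norm_matrix]).  Since [det M] is 1 or -1, the inverse of [M] is the
    adjugate of [M] up to sign, and the adjugate has the same entries up to
    order and signs; so a class and its inverse have the same norm
    ([adjugate_norm], [out_normV]).  The value of beta2 then only requires a
    class of every norm [n >= 2], and the matrix with rows [(1, 0)] and
    [(n - 2, 1)] gives one.

    The norm is at least the entry sum because exponent sums are invariant under
    conjugation and bounded by length.  For the converse one has to conjugate
    the images [u], [v] of the generators simultaneously so that neither word
    contains a generator together with its inverse.  Up to replacing [u] or [v]
    by its inverse, this holds for the pairs obtained from [(a^s, b^t)], with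
    signs [s] and [t], by exchanging the components and by
    [(u, v) -> (u * v, v)]: both words of such a pair use each generator with
    one fixed sign.  This class of pairs is stable, up to conjugation and
    inversion, under all Nielsen moves, because a division either undoes the
    last multiplication or can be rewritten as a multiplication after a
    conjugation ([coherent_div]).

    It remains to see that Nielsen moves and conjugations connect every basis to
    [(a, b)] ([generating_nielsen_pair]).  This is Nielsen's reduction argument,
    carried out with Gromov products in the Cayley tree: the length of a product
    is determined by a Gromov product, and Gromov products are ultrametric.  If
    no Nielsen move shortens [(u, v)] but the pair is still not reduced, then
    one component is half cancelled from each side by the other one, and then a
    conjugation shortens the pair ([conjugate_shortening]).  In a reduced pair
    some letter of every factor survives in every product, so the generators
    can only be reached when both components are letters
    ([nielsen_reduced_length1]). *)

Set Implicit Arguments.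
Unset Strict Implicit.
Unset Printing Implicit Defensive.

(** * Length and Gromov product in a free group *)

Fixpoint common_prefix (T : eqType) (s t : seq T) : nat :=
  match s, t with
  | x :: s', y :: t' => if x == y then (common_prefix s' t').+1 else 0
  | _, _ => 0
  end.

Section CommonPrefix.
Variable T : eqType.
Implicit Types s t r : seq T.

Lemma common_prefixC s t : common_prefix s t = common_prefix t s.
Proof. by elim: s t => [|x s IH] [|y t] //=; rewrite eq_sym IH. Qed.

Lemma common_prefix_ultra s t r :
  minn (common_prefix s t) (common_prefix t r) <= common_prefix s r.
Proof.
elim: s t r => [|x s IH] [|y t] [|z r] //=; rewrite ?minn0 ?min0n //.
case: (x =P y) => [<-|_]; last by rewrite min0n.
by case: eqP => _ //; rewrite minnSS ltnS.
Qed.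

Lemma common_prefix_size s t : common_prefix s t <= size s.
Proof. by elim: s t => [|x s IH] [|y t] //=; case: ifP => // _; apply: IH. Qed.

Lemma common_prefix_take h s : h <= size s -> common_prefix (take h s) s = h.
Proof. by elim: s h => [|x s IH] [|h] //=; rewrite ltnS eqxx => /IH ->. Qed.

Lemma common_prefix_nth x0 s t i :
  i < common_prefix s t -> nth x0 s i = nth x0 t i.
Proof.
by elim: s t i => [|x s IH] [|y t] //= [|i]; case: eqP => // _; apply: IH.
Qed.

End CommonPrefix.

(** The group, as opposed to its carrier, so that products are elaborated over a
    single structure. *)
Definition FG (X : choiceType) : groupType := free_group X.

Section Metric.
Variable X : choiceType.
Implicit Types (l m : letter X) (s t : seq (letter X)) (x y z : FG X).

Local Notation len := (@fg_length X).

Lemma fg_cat_reduced s t : reduced (s ++ t) -> fg_cat s t = s ++ t.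
Proof.
elim: s => [|l s IH] //= rst; rewrite IH; last exact: path_sorted rst.
by case: (s ++ t) rst => [|m r] //= /andP[/negbTE ->].
Qed.

(** Only the common prefix of [s] and [t] cancels between the inverse of [s] and
    [t]. *)
Lemma size_fg_cat_inv s t : reduced s -> reduced t ->
  size (fg_cat (fg_invw s) t) + (common_prefix s t).*2 = size s + size t.
Proof.
elim: s t => [|l s IH] t rs rt; first by rewrite addn0.
have rs' : reduced s by exact: path_sorted rs.
have rI := reduced_inv rs.
rewrite /fg_invw /= rev_cons -/(fg_invw s).
case: t rt => [|m t] rt.
  by rewrite fg_cat0 ?addn0 //= ?size_rcons ?size_rev ?size_map // -rev_cons.
rewrite /fg_cat foldr_rcons /= inv_letterK eq_sym.
case: eqP => [_|/eqP ne] /=.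
  by have := IH t rs' (path_sorted rt); rewrite /fg_cat; lia.
rewrite -/(fg_cat _ _) fg_cat_reduced; first last.
  rewrite -cat_rcons /reduced; move: rI; rewrite /fg_invw /= rev_cons.
  rewrite /reduced; case E: (rcons _ _) => [|n r]; first by case: (rev _) E.
  rewrite cat_cons /= cat_path => ->; rewrite -[last n r]/(last n (n :: r)) -E.
  by rewrite last_rcons /= inv_letterK eq_sym ne.
by rewrite size_cat /= /fg_invw size_rev size_map; lia.
Qed.

(** The length of the common initial segment of the geodesics from 1 to [x] and
    to [y] in the Cayley tree. *)
Definition gromov x y : nat := common_prefix (fg_word x) (fg_word y).

Lemma gromovC x y : gromov x y = gromov y x.
Proof. exact: common_prefixC. Qed.

(** The Cayley graph is a tree. *)
Lemma gromov_ultra x y z : minn (gromov x y) (gromov y z) <= gromov x z.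
Proof. exact: common_prefix_ultra. Qed.

Lemma gromov_lel x y : gromov x y <= len x.
Proof. exact: common_prefix_size. Qed.

Lemma gromov_ler x y : gromov x y <= len y.
Proof. by rewrite gromovC gromov_lel. Qed.

Lemma fg_length1 : len 1%g = 0.
Proof. by []. Qed.

Lemma fg_lengthV x : len x^-1%g = len x.
Proof. by rewrite /fg_length /= /fg_invw size_rev size_map. Qed.

Lemma fg_length_mul x y : len (x * y)%g + (gromov x^-1 y).*2 = len x + len y.
Proof.
rewrite -(fg_lengthV x) /fg_length /gromov.
by rewrite -size_fg_cat_inv ?fg_invwK //; apply: valP.
Qed.

Lemma gromov_mulr x y : gromov (x * y)%g x + gromov x^-1 y = len x.
Proof.
have := fg_length_mul x y; have := fg_length_mul (x * y)^-1%g x.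
by rewrite fg_lengthV invgK invgM -mulgA mulVg mulg1 fg_lengthV; lia.
Qed.

Lemma fg_length_eq0 x : len x = 0 -> x = 1%g.
Proof. by move/size0nil => e; apply: val_inj; rewrite /= e. Qed.

Lemma geodesic_point x h : h <= len x ->
  exists p, len p = h /\ gromov p x = h.
Proof.
move=> hx; have rp : reduced (take h (fg_word x)).
  by apply: take_sorted; apply: valP x.
exists (FreeGroup rp); split; last exact: common_prefix_take.
by rewrite /fg_length /= size_takel.
Qed.

(** If half of [x] cancelled in [x * x], the two middle letters of [x] would be
    inverse to each other, or its middle letter would be its own inverse. *)
Lemma gromov_sqr x : x <> 1%g -> (gromov x^-1 x).*2 < len x.
Proof.
move=> nx; rewrite ltnNge; apply/negP => le.
have nz : 0 < len x by rewrite lt0n; apply/eqP => /fg_length_eq0.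
case E: (fg_word x) nz le (valP x) => [|l0 s'] nz le rx.
  by move: nz; rewrite /fg_length E.
rewrite -[val x]/(fg_word x) in rx; set s := fg_word x in E rx *; set n := size s.
have nE : len x = n by [].
set i := n.-1./2.
have := common_prefix_nth l0 (s := fg_invw s) (t := s) (i := i).
have iL : i < common_prefix (fg_invw s) s.
  by move: le; rewrite /gromov /= -/s nE /i; rewrite nE in nz; lia.
move/(_ iL).
have iN : i < n by rewrite nE in nz; rewrite /i; lia.
rewrite /fg_invw nth_rev size_map // (nth_map l0); last by rewrite -/n; lia.
rewrite -/n; case: (odd n) (odd_double_half n) => /= nO.
  have -> : n - i.+1 = i by rewrite /i; lia.
  by case: (nth _ _ _) => y [].
have -> : n - i.+1 = i.+1 by rewrite /i; lia.
have iS : i.+1 < size s by rewrite -/n /i; rewrite nE in nz; lia.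
move=> eI; have := sortedP l0 rx => /(_ i iS); rewrite -eI.
by rewrite inv_letterK eqxx.
Qed.

(** Here [y = p * q^-1] with both halves of equal length, and [x] reads
    [q * z * p^-1]; conjugating by [q] turns [x * y] into [z] and [y] into the
    cyclic permutation [q^-1 * p]. *)
Lemma conjugate_shortening x y h :
  gromov x^-1 y = h -> gromov y^-1 x = h -> len y = h.*2 -> h.*2 <= len x ->
  exists q, len ((x * y) ^ q)%g + len (y ^ q)%g <= len x.
Proof.
move=> xy yx yh xh.
have hy : h <= len y^-1%g by rewrite fg_lengthV yh; lia.
have [q [lq qy]] := geodesic_point hy.
pose p : FG X := (y * q)%g.
have lp : len p = h.
  by have := fg_length_mul y q; rewrite (gromovC y^-1%g) qy lq yh -/p; lia.
have py : h <= gromov p y.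
  by have := gromov_mulr y q; rewrite (gromovC y^-1%g) qy yh -/p; lia.
have pE : gromov x^-1%g p = h.
  have := gromov_ultra x^-1%g y p; have := gromov_ler x^-1%g p.
  by rewrite xy (gromovC y) lp; lia.
have qx : gromov q x = h.
  have := gromov_ultra q y^-1%g x; have := gromov_lel q x.
  by rewrite qy yx lq; lia.
pose z : FG X := (q^-1 * x)%g.
have lz : len z + h = len x.
  by have := fg_length_mul q^-1%g x; rewrite invgK qx fg_lengthV lq -/z; lia.
have zE : z^-1%g = (x^-1 * q)%g by rewrite /z invgM invgK.
have zp : h <= gromov z^-1%g p.
  have := gromov_ultra z^-1%g x^-1%g p; rewrite pE.
  have := gromov_mulr x^-1%g q; rewrite invgK (gromovC x) qx fg_lengthV.
  by rewrite -zE; lia.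
have E1 : ((x * y) ^ q = z * p)%g by rewrite conjgE /z /p !mulgA.
have E2 : (y ^ q = q^-1 * p)%g by rewrite conjgE.
exists q; have := fg_length_mul z p; have := fg_length_mul q^-1%g p.
by rewrite -E1 -E2 fg_lengthV lq lp; lia.
Qed.

End Metric.

(** * Homomorphisms out of a free group *)

Section GroupMorphisms.
Variables (G H : groupType) (f : G -> H).
Local Open Scope group_scope.
Hypothesis fM : {morph f : x y / x * y}.

Lemma morph_one : f 1 = 1.
Proof. by apply: (@mulgI _ (f 1)); rewrite -fM !mulg1. Qed.

Lemma morph_inv x : f x^-1 = (f x)^-1.
Proof. by apply: (@mulgI _ (f x)); rewrite -fM !mulgV morph_one. Qed.

End GroupMorphisms.

Section Evaluation.
Variables (X : choiceType) (G : groupType) (f : X -> G).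
Local Open Scope group_scope.
Implicit Types (l m : letter X) (s t : seq (letter X)) (x y : FG X).

Definition letter_eval l : G := if l.2 then (f l.1)^-1 else f l.1.

Definition word_eval s : G := foldr (fun l g => letter_eval l * g) 1 s.

Definition fg_eval x : G := word_eval (fg_word x).

Lemma letter_evalV l : letter_eval (inv_letter l) = (letter_eval l)^-1.
Proof. by case: l => i [] /=; rewrite /letter_eval //= invgK. Qed.

Lemma word_eval_push l s : word_eval (fg_push l s) = letter_eval l * word_eval s.
Proof.
case: s => [|m s] //=; case: eqP => [->|//].
by rewrite letter_evalV mulVKg.
Qed.

Lemma fg_eval_morph : {morph fg_eval : x y / x * y}.
Proof.
move=> x y; rewrite /fg_eval /=.
elim: (fg_word x) => [|l s IH] /=; first by rewrite mul1g.
by rewrite word_eval_push IH mulgA.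
Qed.

Lemma fg_eval_gen i : fg_eval (fg_gen i) = f i.
Proof. by rewrite /fg_eval /= mulg1. Qed.

End Evaluation.

Section Universal.
Variables (X : choiceType).
Local Open Scope group_scope.
Implicit Types (x y : FG X).

Lemma fg_ind (P : FG X -> Prop) :
  P 1 -> (forall i x, P x -> P (fg_gen i * x)) ->
  (forall i x, P x -> P ((fg_gen i)^-1 * x)) -> forall x, P x.
Proof.
move=> P1 Pp Pn [s rs]; elim: s rs => [|[i b] s IH] rs.
  by rewrite (_ : FreeGroup _ = 1) //; apply: val_inj.
have rs' : reduced s by exact: path_sorted rs.
have E : fg_push (i, b) s = (i, b) :: s.
  by case: s rs {IH rs'} => [|m s] //= /andP[/negbTE ->].
case: b rs E => rs E; [have := Pn i _ (IH rs')|have := Pp i _ (IH rs')];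
by rewrite (_ : _ * _ = FreeGroup rs) //; apply: val_inj; rewrite /= -?E.
Qed.

Lemma fg_hom_ext (G : groupType) (g h : FG X -> G) :
  {morph g : x y / x * y} -> {morph h : x y / x * y} ->
  (forall i, g (fg_gen i) = h (fg_gen i)) -> g =1 h.
Proof.
move=> gM hM e; apply: fg_ind => [|i x IH|i x IH]; first by rewrite !morph_one.
  by rewrite gM hM e IH.
by rewrite gM hM (morph_inv gM) (morph_inv hM) e IH.
Qed.

End Universal.

(** * Nielsen reduced families *)

Section NielsenReduced.
Variables (X Y : choiceType) (f : X -> FG Y).
Implicit Types (l m n : letter X) (s : seq (letter X)).

Local Notation len := (@fg_length Y).
Local Notation img := (letter_eval f).

(** The number of letter pairs which cancel between the images of [l] and [m]. *)
Definition cancellation l m : nat := gromov (img (inv_letter l)) (img m).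

Lemma cancellationC l m :
  cancellation l m = cancellation (inv_letter m) (inv_letter l).
Proof. by rewrite /cancellation inv_letterK gromovC. Qed.

(** Nielsen's conditions: at most half of a factor cancels on one side, and no
    factor cancels completely between its two neighbours. *)
Hypothesis half : forall l m, m <> inv_letter l ->
  (cancellation l m).*2 <= len (img l) /\ (cancellation l m).*2 <= len (img m).
Hypothesis core : forall l m n, m <> inv_letter l -> n <> inv_letter m ->
  cancellation l m + cancellation m n < len (img m).

Lemma img_gt0 l : 0 < len (img l).
Proof.
have nl : l <> inv_letter l by case: l => i [].
by apply: leq_ltn_trans (core nl nl).
Qed.

(** Some letter of every image survives on both sides of a cancellation, so by
    ultrametricity the cancellation in front of [l] is the same against
    [word_eval f (l :: s)] as against the image of [l] alone. *)
Lemma nielsen_reduced_cons l m s : reduced (l :: m :: s) ->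
  len (word_eval f (l :: m :: s)) + (cancellation l m).*2 =
    len (img l) + len (word_eval f (m :: s)) /\
  gromov (word_eval f (l :: m :: s)) (img l) + cancellation l m = len (img l).
Proof.
elim: s l m => [|n s IH] l m /=.
  move=> /andP[/eqP lm _]; rewrite mulg1.
  by rewrite /cancellation letter_evalV fg_length_mul gromov_mulr.
move=> /andP[/eqP ml rs]; have [/= _ g] := IH m n rs.
have nm : n <> inv_letter m by move: rs => /= /andP[/eqP].
set y := (img m * _)%g in g *.
have cE : gromov (img (inv_letter l)) y = cancellation l m.
  have h1 := gromov_ultra (img (inv_letter l)) (img m) y.
  have h2 := gromov_ultra (img (inv_letter l)) y (img m).
  have h3 := core ml nm.
  rewrite (gromovC (img m) y) -/(cancellation l m) in h1 h2; lia.
by rewrite -cE letter_evalV fg_length_mul gromov_mulr.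
Qed.

Lemma nielsen_reduced_ge l s :
  reduced (l :: s) -> len (img l) <= len (word_eval f (l :: s)).
Proof.
elim: s l => [|m s IH] l rs; first by rewrite /= mulg1.
have [h _] := nielsen_reduced_cons rs.
have := IH m (path_sorted rs).
have ml : m <> inv_letter l by move: rs => /= /andP[/eqP].
by have := half ml; lia.
Qed.

Lemma nielsen_reduced_length1 s : reduced s -> len (word_eval f s) = 1 ->
  exists l, s = [:: l].
Proof.
case: s => [|l [|m s]] rs; first by rewrite fg_length1.
  by move=> _; exists l.
have [h _] := nielsen_reduced_cons rs.
have := nielsen_reduced_ge rs; have := nielsen_reduced_ge (path_sorted rs).
have := img_gt0 l; have := img_gt0 m.
have ml : m <> inv_letter l by move: rs => /= /andP[/eqP].
by have := half ml; lia.
Qed.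

End NielsenReduced.

(** * Exponent sums *)

Section ExponentSum.
Variable X : choiceType.
Implicit Types (i j : X) (l : letter X) (s : seq (letter X)) (x y : FG X).
Local Open Scope ring_scope.
Import GRing.Theory Num.Theory.

Definition letter_exp i l : int := if l.1 == i then (-1) ^+ l.2 else 0.

Definition exp_sum i x : int := \sum_(l <- fg_word x) letter_exp i l.

Lemma exp_sum1 i : exp_sum i 1%g = 0.
Proof. by rewrite /exp_sum big_nil. Qed.

Lemma exp_sum_gen i j : exp_sum i (fg_gen j) = (j == i)%:R.
Proof. by rewrite /exp_sum big_seq1 /letter_exp /=; case: eqP. Qed.

Lemma exp_sumM i x y : exp_sum i (x * y)%g = exp_sum i x + exp_sum i y.
Proof.
rewrite /exp_sum /=; elim: (fg_word x) => [|l s IH] /=.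
  by rewrite big_nil add0r.
rewrite big_cons -addrA -IH; case: (fg_cat _ _) => [|m t] /=.
  by rewrite big_seq1 big_nil addr0.
case: eqP => [->|_]; last by rewrite big_cons.
rewrite big_cons addrA -[LHS]add0r; congr (_ + _); rewrite /letter_exp /=.
by case: ifP => _; [case: l.2|]; rewrite ?addNr ?addrN ?addr0.
Qed.

Lemma exp_sumV i x : exp_sum i x^-1%g = - exp_sum i x.
Proof. by apply: (addrI (exp_sum i x)); rewrite -exp_sumM mulgV exp_sum1 addrN. Qed.

Lemma exp_sumJ i x y : exp_sum i (x ^ y)%g = exp_sum i x.
Proof. by rewrite !exp_sumM exp_sumV addrC addrK. Qed.

End ExponentSum.

Section RankTwo.
Local Open Scope ring_scope.
Import GRing.Theory Num.Theory.

(** The values at the images of the two generators are the rows of the matrix by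
    which an endomorphism of F2 acts on the abelianization. *)
Definition exp_a (x : F2) : int := exp_sum (ord0 : 'I_2) x.
Definition exp_b (x : F2) : int := exp_sum (ord_max : 'I_2) x.

Definition exp_norm (x : F2) : nat := (`|exp_a x| + `|exp_b x|)%N.

Lemma I2P (P : 'I_2 -> Prop) : P ord0 -> P ord_max -> forall i, P i.
Proof.
move=> P0 P1 [[|[|//]] lt_i].
  by rewrite (_ : Ordinal _ = ord0) //; apply: val_inj.
by rewrite (_ : Ordinal _ = ord_max) //; apply: val_inj.
Qed.

Lemma exp_sum_morph (f : F2 -> F2) (i : 'I_2) : {morph f : x y / (x * y)%g} ->
  forall x, exp_sum i (f x) =
    exp_a x * exp_sum i (f gen_a) + exp_b x * exp_sum i (f gen_b).
Proof.
move=> fM; rewrite /exp_a /exp_b; apply: fg_ind => [|j x IH|j x IH].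
- by rewrite morph_one // !exp_sum1 !mul0r addr0.
- rewrite fM !exp_sumM IH !exp_sum_gen; elim/I2P: j => /=;
  by rewrite -/gen_a -/gen_b; ring.
- rewrite fM morph_inv // !exp_sumM !exp_sumV IH !exp_sum_gen.
  by elim/I2P: j => /=; rewrite -/gen_a -/gen_b; ring.
Qed.

Lemma exp_norm_le (x : F2) : (exp_norm x <= fg_length x)%N.
Proof.
rewrite /exp_norm /exp_a /exp_b /exp_sum /fg_length.
elim: (fg_word x) => [|[i c] s IH]; first by rewrite !big_nil.
rewrite !big_cons /=; move: (\sum_(l <- s) _) (\sum_(l <- s) _) IH => A B IH.
by rewrite /letter_exp; elim/I2P: i => /=; case: c; rewrite ?expr1 ?expr0; lia.
Qed.

(** In a word where each generator occurs with a constant sign nothing cancels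
    under abelianization. *)
Lemma exp_norm_monotone (sg : 'I_2 -> bool) (x : F2) :
  all (fun l => l.2 == sg l.1) (fg_word x) -> exp_norm x = fg_length x.
Proof.
move=> mx; rewrite /exp_norm /fg_length.
have E (i : 'I_2) :
    exp_sum i x = (-1) ^+ sg i * (count (fun l => l.1 == i) (fg_word x))%:Z.
  rewrite /exp_sum; elim: (fg_word x) mx => [|[j c] s IH] /=.
    by rewrite big_nil mulr0.
  move=> /andP[/eqP -> ms]; rewrite big_cons (IH ms) /letter_exp /=.
  by case: eqP => [->|_]; rewrite PoszD mulrDr ?mulr1 ?mulr0 // add0r.
rewrite /exp_a /exp_b !E !abszMsign !absz_nat.
elim: (fg_word x) {mx E} => [|[i c] s IH] //=; rewrite -IH.
by elim/I2P: i => /=; lia.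
Qed.

End RankTwo.

(** The two matrices are inverse to each other; the second is the adjugate of the
    first multiplied by a determinant which is 1 or -1. *)
Lemma adjugate_norm (p q r s p' q' r' s' : int) :
  (p * p' + q * r' = 1)%R -> (p * q' + q * s' = 0)%R ->
  (r * p' + s * r' = 0)%R -> (r * q' + s * s' = 1)%R ->
  `|p'| + `|q'| + (`|r'| + `|s'|) = `|p| + `|q| + (`|r| + `|s|).
Proof.
move=> e1 e2 e3 e4; pose D := (p * s - q * r)%R.
have D1 : (D * (p' * s' - q' * r') = 1)%R.
  by transitivity ((p * p' + q * r') * (r * q' + s * s') -
    (p * q' + q * s') * (r * p' + s * r'))%R; [rewrite /D; ring | rewrite e1 e2 e3 e4].
have {D1} D1 : `|D| = 1%N.
  by apply/eqP; move/(congr1 absz)/eqP: D1; rewrite abszM muln_eq1 => /andP[].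
have Dl x y : (D * x = y)%R -> `|x| = `|y| by move=> <-; rewrite abszM D1 mul1n.
have -> : `|p'| = `|s|.
  apply: Dl; transitivity (s * (p * p' + q * r') - q * (r * p' + s * r'))%R.
    by rewrite /D; ring.
  by rewrite e1 e3; ring.
have -> : `|q'| = `|q|.
  rewrite -abszN; apply: Dl.
  transitivity (q * (r * q' + s * s') - s * (p * q' + q * s'))%R.
    by rewrite /D; ring.
  by rewrite e2 e4; ring.
have -> : `|r'| = `|r|.
  rewrite -abszN; apply: Dl.
  transitivity (r * (p * p' + q * r') - p * (r * p' + s * r'))%R.
    by rewrite /D; ring.
  by rewrite e1 e3; ring.
have -> : `|s'| = `|p|.
  apply: Dl; transitivity (p * (r * q' + s * s') - r * (p * q' + q * s'))%R.
    by rewrite /D; ring.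
  by rewrite e2 e4; ring.
lia.
Qed.

(** * Nielsen transformations of generating pairs *)

Section Pairs.
Local Open Scope group_scope.
Import GRing.Theory.
Implicit Types (u v x y g : F2) (l m n : letter 'I_2).

Definition pair_fun u v (i : 'I_2) : F2 := if i == ord0 then u else v.

Definition in_span u v x := exists w : F2, fg_eval (pair_fun u v) w = x.

Definition generates u v := forall x, in_span u v x.

Lemma in_spanl u v : in_span u v u.
Proof. by exists gen_a; rewrite fg_eval_gen. Qed.

Lemma in_spanr u v : in_span u v v.
Proof. by exists gen_b; rewrite fg_eval_gen. Qed.

Lemma in_spanM u v x y : in_span u v x -> in_span u v y -> in_span u v (x * y).
Proof. by move=> [w <-] [z <-]; exists (w * z); rewrite fg_eval_morph. Qed.

Lemma in_spanV u v x : in_span u v x -> in_span u v x^-1.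
Proof.
by move=> [w <-]; exists w^-1; rewrite (morph_inv (@fg_eval_morph _ _ _)).
Qed.

Lemma generates_trans u v u' v' : generates u v ->
  in_span u' v' u -> in_span u' v' v -> generates u' v'.
Proof.
move=> guv hu hv x; have [w <-] := guv x.
have h i : in_span u' v' (pair_fun u v i) by rewrite /pair_fun; case: ifP.
elim/fg_ind: w => [|i w IH|i w IH].
- by exists 1; rewrite !(morph_one (@fg_eval_morph _ _ _)).
- by rewrite fg_eval_morph fg_eval_gen; apply: in_spanM.
- rewrite fg_eval_morph (morph_inv (@fg_eval_morph _ _ _)) fg_eval_gen.
  by apply: in_spanM => //; apply: in_spanV.
Qed.

Lemma generates_conj u v g : generates u v -> generates (u ^ g) (v ^ g).
Proof.
move=> guv x; have [w e] := guv (x ^ g^-1); exists w.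
rewrite -[x](conjgKV g) -e.
apply: (@fg_hom_ext _ _ _ (fun w => fg_eval (pair_fun u v) w ^ g)).
- exact: fg_eval_morph.
- by move=> y z; rewrite fg_eval_morph conjMg.
- by move=> i; rewrite !fg_eval_gen /pair_fun; case: ifP.
Qed.

Lemma generates_mul u v : generates u v -> generates (u * v) v.
Proof.
move/generates_trans; apply; last exact: in_spanr.
rewrite -[X in in_span _ _ X](mulgK v u).
by apply: in_spanM; [apply: in_spanl|apply/in_spanV/in_spanr].
Qed.

(** The abelianization, free of rank 2, cannot be generated by one element. *)
Lemma generates_neq1 u v : generates u v -> u <> 1.
Proof.
move=> guv u1; rewrite {}u1 in guv.
have [w wa] := guv gen_a; have [z zb] := guv gen_b.
have E i y := exp_sum_morph i (@fg_eval_morph _ _ (pair_fun 1 v)) y.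
have := E ord0 w; have := E ord_max w; have := E ord0 z; have := E ord_max z.
rewrite !wa !zb !fg_eval_gen /= !exp_sum1 !exp_sum_gen /=.
rewrite !mulr0 !add0r; set p := exp_b w; set r := exp_b z.
move: (exp_sum _ _) (exp_sum _ _) => s q zs zq ws wq.
have : (p * q * (r * s) = p * s * (r * q))%R by ring.
by rewrite -zs -zq -ws -wq.
Qed.

(** Conjugation is among the moves because the reduction of a pair uses it, at no
    cost: only the outer class of an automorphism matters. *)
Inductive nielsen_pair : F2 -> F2 -> Prop :=
| nielsen_base : nielsen_pair gen_a gen_b
| nielsen_swap u v : nielsen_pair u v -> nielsen_pair v u
| nielsen_inv u v : nielsen_pair u v -> nielsen_pair u^-1 v
| nielsen_mul u v : nielsen_pair u v -> nielsen_pair (u * v) v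
| nielsen_conj u v g : nielsen_pair u v -> nielsen_pair (u ^ g) (v ^ g).

Lemma nielsen_invr u v : nielsen_pair u v -> nielsen_pair u v^-1.
Proof. by move=> h; apply/nielsen_swap/nielsen_inv/nielsen_swap. Qed.

Lemma nielsen_mulV u v : nielsen_pair (u * v) v -> nielsen_pair u v.
Proof.
move/nielsen_invr/nielsen_mul/nielsen_invr; by rewrite mulgK invgK.
Qed.

Lemma nielsen_conjV u v g : nielsen_pair (u ^ g) (v ^ g) -> nielsen_pair u v.
Proof. by move/(nielsen_conj g^-1); rewrite !conjgK. Qed.

Local Notation img u v := (letter_eval (pair_fun u v)).

(** A property of pairs invariant under exchange and inversion may be checked on
    letters of the two different generators: this removes the choice of signs
    and of the order of [u] and [v] from the reduction argument. *)
Lemma letters_to_pair u v l m (P : F2 -> F2 -> Prop) : l.1 != m.1 ->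
  (forall x y, P x y -> P y x) -> (forall x y, P x y -> P x^-1 y) ->
  P (img u v l) (img u v m) -> P u v.
Proof.
move=> lm sw iv; have ivr x y : P x y -> P x y^-1 by move=> /sw/iv/sw.
suff h x y (b c : bool) :
    P (if b then x^-1 else x) (if c then y^-1 else y) -> P x y.
  case: l m lm => [i b] [j c] /=; rewrite /letter_eval /=.
  by elim/I2P: i; elim/I2P: j => //= _; rewrite /pair_fun /=; move/h => // /sw.
by case: b c => [] [] //; [move=> /iv/ivr|move=> /iv|move=> /ivr]; rewrite !invgK.
Qed.

(** Descent on the total length: unless the pair is Nielsen reduced, a Nielsen
    move or a conjugation shortens it, and a reduced generating pair consists
    of two letters.  The classical order that decides between elements of equal
    length is replaced by [conjugate_shortening]. *)
Lemma generating_nielsen_pair u v : generates u v -> nielsen_pair u v.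
Proof.
have [N] := ubnP (fg_length u + fg_length v).
elim: N u v => // N IHN u v; rewrite ltnS => leN guv.
have IH u' v' : generates u' v' ->
    fg_length u' + fg_length v' < fg_length u + fg_length v -> nielsen_pair u' v'.
  by move=> g' lt'; apply: IHN => //; apply: leq_trans leN.
apply: contrapT => nNP; pose f := pair_fun u v; pose im := letter_eval f.
have imV l : im (inv_letter l) = (im l)^-1 by exact: letter_evalV.
have cE l m : cancellation f l m = gromov (im l)^-1 (im m).
  by rewrite /cancellation letter_evalV.
have lenM x y : fg_length (x * y) + (gromov x^-1 y).*2 = fg_length x + fg_length y.
  exact: fg_length_mul.
have len_im l : fg_length (im (inv_letter l)) = fg_length (im l).
  by rewrite imV fg_lengthV.
have gen_im l m : l.1 != m.1 -> generates (im l) (im m).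
  move=> lm; pose S := in_span (im l) (im m).
  have [] : S u /\ S v.
    apply: (letters_to_pair (P := fun x y => S x /\ S y) lm) => [x y []|x y []|] //.
      by move=> Sx Sy; split=> //; apply: in_spanV.
    by split; [apply: in_spanl|apply: in_spanr].
  exact: generates_trans guv.
have np_im l m : l.1 != m.1 -> ~ nielsen_pair (im l) (im m).
  move=> lm np; apply: nNP; apply: (letters_to_pair lm nielsen_swap nielsen_inv np).
have len_sum l m : l.1 != m.1 ->
    fg_length (im l) + fg_length (im m) = fg_length u + fg_length v.
  move=> lm; pose P x y := fg_length (im l) + fg_length (im m) =
    fg_length x + fg_length y.
  apply: (letters_to_pair (P := P) lm) => // x y; rewrite /P.
    by rewrite (addnC (fg_length x)).
  by rewrite fg_lengthV.
have neq1 l : im l <> 1.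
  have [m lm] : exists m : letter 'I_2, l.1 != m.1.
    by case: l => i b; elim/I2P: i; [exists (ord_max, b)|exists (ord0, b)].
  exact: generates_neq1 (gen_im _ _ lm).
have self l : (cancellation f l l).*2 < fg_length (im l).
  by rewrite cE; apply: gromov_sqr; apply: neq1.
have same l m : m <> inv_letter l -> l.1 = m.1 -> m = l.
  case: l m => [i b] [j c] /= ne e; rewrite -{}e in ne *; congr pair.
  by case: b c ne => [] [] //; rewrite /inv_letter /= => /(_ erefl).
have halfr l m : l.1 != m.1 -> (cancellation f l m).*2 <= fg_length (im m).
  (* Otherwise [im l * im m] would be shorter than [im l]. *)
  move=> lm; rewrite leqNgt; apply/negP => lt.
  apply: (np_im _ _ lm); apply: nielsen_mulV; apply: IH.
    exact/generates_mul/gen_im.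
  rewrite -(len_sum _ _ lm) ltn_add2r; move: lt; rewrite cE.
  by have := lenM (im l) (im m); lia.
have half l m : m <> inv_letter l ->
    (cancellation f l m).*2 <= fg_length (im l) /\
    (cancellation f l m).*2 <= fg_length (im m).
  move=> ml; have [/(same _ _ ml) ->|lm] := eqVneq l.1 m.1.
    by split; apply/ltnW/self.
  split; last exact: halfr.
  by rewrite cancellationC -len_im; apply: halfr; rewrite /= eq_sym.
have core l m n : m <> inv_letter l -> n <> inv_letter m ->
    cancellation f l m + cancellation f m n < fg_length (im m).
  move=> ml nm; have [_ hlm] := half _ _ ml; have [hmn _] := half _ _ nm.
  have [e|lm] := eqVneq l.1 m.1.
    by move: hmn; have := self l; rewrite (same _ _ ml e); lia.
  have [e|mn] := eqVneq m.1 n.1.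
    by move: hlm; have := self m; rewrite (same _ _ nm e); lia.
  rewrite ltnNge; apply/negP => le.
  (* Both halves of [im m] cancel, against letters of the other generator. *)
  pose h := cancellation f l m.
  have mh : fg_length (im m) = h.*2 by rewrite /h; lia.
  have hE : cancellation f m n = h by rewrite /h; lia.
  have nE : n = l \/ n = inv_letter l.
    case: l m n {ml nm hlm hmn le h mh hE} lm mn => [i b] [j c] [k d] /=.
    elim/I2P: i; elim/I2P: j => //; elim/I2P: k => // _ _;
    by case: b d => [] []; [left|right|right|left].
  have hl : h.*2 <= fg_length (im l) by have [] := half _ _ ml.
  rewrite cE in hE; case: nE => nE; subst n.
    (* The two neighbours coincide: conjugation shortens [(im l * im m, im m)]. *)
    have [q] := @conjugate_shortening _ (im l) (im m) h (esym (cE l m)) hE mh hl.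
    move=> short; apply: (np_im _ _ lm); apply/nielsen_mulV/(@nielsen_conjV _ _ q)/IH.
      exact/generates_conj/generates_mul/gen_im.
    rewrite -(len_sum _ _ lm); apply: leq_ltn_trans short _.
    by rewrite -[X in X < _]addn0 ltn_add2l lt0n; apply/eqP => /fg_length_eq0/neq1.
  (* The neighbours are mutually inverse: [im m] would start like its inverse on
     half of its length. *)
  rewrite imV in hE; have sq := self m; rewrite cE in sq.
  have : minn h h <= gromov (im m)^-1 (im m).
    by rewrite -{1}hE /h cE; apply: gromov_ultra.
  by rewrite minnn; lia.
have [l wl] : exists l, im l = gen_a.
  have [w wa] := guv gen_a.
  have [||l e] := @nielsen_reduced_length1 _ _ f half core (fg_word w).
  - exact: valP.
  - by rewrite -/(fg_eval f w) wa.
  by exists l; rewrite -wa /fg_eval e /= mulg1.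
have [m wm] : exists m, im m = gen_b.
  have [w wb] := guv gen_b.
  have [||m e] := @nielsen_reduced_length1 _ _ f half core (fg_word w).
  - exact: valP.
  - by rewrite -/(fg_eval f w) wb.
  by exists m; rewrite -wb /fg_eval e /= mulg1.
have [e|lm] := eqVneq l.1 m.1.
  have [mE|mE] : m = l \/ m = inv_letter l.
  - by case: l m e {wl wm} => [i b] [j c] /= ->; case: b c => [] []; [left|right|right|left].
  - by move: wm; rewrite mE wl => /(congr1 exp_a); rewrite /exp_a !exp_sum_gen.
  - move: wm; rewrite mE imV wl => /(congr1 exp_a).
    by rewrite /exp_a exp_sumV !exp_sum_gen.
by apply: (np_im _ _ lm); rewrite wl wm; apply: nielsen_base.
Qed.

End Pairs.

(** * Sign-coherent representatives *)

Section Coherent.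
Local Open Scope group_scope.
Implicit Types (u v x y g : F2) (s t : bool).

Definition signed s x : F2 := if s then x^-1 else x.

Lemma signedN s x : signed (~~ s) x^-1 = signed s x.
Proof. by case: s => //=; rewrite invgK. Qed.

Lemma signed_conj s x g : signed s (x ^ g) = signed s x ^ g.
Proof. by case: s => //=; rewrite conjVg. Qed.

(** Without inversion and conjugation no letter ever cancels, so both words keep
    the signs chosen for the two generators at the base. *)
Inductive coherent_pair : F2 -> F2 -> Prop :=
| coherent_base s t : coherent_pair (signed s gen_a) (signed t gen_b)
| coherent_swap u v : coherent_pair u v -> coherent_pair v u
| coherent_mul u v : coherent_pair u v -> coherent_pair (u * v) v.

(** The inversions act on [u] and [v], whereas the signs of the generators are
    absorbed in [coherent_base]. *)
Definition essentially_coherent u v := exists s t g,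
  coherent_pair (signed s u ^ g) (signed t v ^ g).

Lemma coherent_essentially u v : coherent_pair u v -> essentially_coherent u v.
Proof. by exists false, false, 1; rewrite !conjg1. Qed.

Lemma essentially_coherent_swap u v :
  essentially_coherent u v -> essentially_coherent v u.
Proof. by move=> [s [t [g h]]]; exists t, s, g; apply: coherent_swap. Qed.

Lemma essentially_coherent_inv u v :
  essentially_coherent u v -> essentially_coherent u^-1 v.
Proof. by move=> [s [t [g h]]]; exists (~~ s), t, g; rewrite signedN. Qed.

Lemma essentially_coherent_conj u v g :
  essentially_coherent u v -> essentially_coherent (u ^ g) (v ^ g).
Proof.
move=> [s [t [h p]]]; exists s, t, (g^-1 * h).
by rewrite !conjgM !signed_conj !conjgK.
Qed.

Lemma essentially_coherent_invr u v :
  essentially_coherent u v -> essentially_coherent u v^-1.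
Proof.
by move=> h; apply/essentially_coherent_swap/essentially_coherent_inv;
   apply: essentially_coherent_swap.
Qed.

Lemma essentially_coherent_signed s t u v :
  essentially_coherent (signed s u) (signed t v) -> essentially_coherent u v.
Proof.
case: s t => [] [] //= h; first 1 last.
- by rewrite -[u]invgK; apply: essentially_coherent_inv.
- by rewrite -[v]invgK; apply: essentially_coherent_invr.
- rewrite -[u]invgK -[v]invgK.
  by apply/essentially_coherent_inv/essentially_coherent_invr.
Qed.

Lemma essentially_coherent_conjV u v g :
  essentially_coherent (u ^ g) (v ^ g) -> essentially_coherent u v.
Proof. by move/(essentially_coherent_conj g^-1); rewrite !conjgK. Qed.

(** At the base the sign of one generator can be switched.  Otherwise dividing
    either undoes the last multiplication or, for
    [v * (u * v)^-1 = u^-1], leaves a pair conjugate to [(u, v * u)] up to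
    sign. *)
Lemma coherent_div u v : coherent_pair u v ->
  essentially_coherent (u * v^-1) v /\ essentially_coherent (v * u^-1) u.
Proof.
elim=> [s t|{}u {}v _ []//|{}u {}v uv _].
  have h := coherent_base s (~~ t); have h' := coherent_base (~~ s) t.
  have E r x : signed (~~ r) x = (signed r x)^-1 by case: r; rewrite //= invgK.
  rewrite !E in h h'; split; rewrite -[X in essentially_coherent _ X]invgK;
  apply/essentially_coherent_invr/coherent_essentially/coherent_mul => //.
  exact: coherent_swap.
rewrite mulgK; split; first exact: coherent_essentially.
rewrite invgM mulVKg; apply/essentially_coherent_inv.
apply: (@essentially_coherent_conjV _ _ u).
have -> : u ^ u = u by rewrite conjgE mulKg.
have -> : (u * v) ^ u = v * u by rewrite conjgE !mulgA mulVg mul1g.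
by apply/coherent_essentially/coherent_swap/coherent_mul/coherent_swap.
Qed.

Lemma essentially_coherent_mul u v :
  essentially_coherent u v -> essentially_coherent (u * v) v.
Proof.
move=> [s [t [g h]]]; apply: (@essentially_coherent_conjV _ _ g).
rewrite conjMg.
have [hd _] := coherent_div h.
move: h hd; rewrite -!signed_conj; move: (u ^ g) (v ^ g) => x y.
have flip : essentially_coherent (x^-1 * y^-1) y -> essentially_coherent (x * y) y.
  (* [x * y] is the inverse of a conjugate of [x^-1 * y^-1] *)
  move=> e; rewrite -[x * y]invgK; apply: essentially_coherent_inv; rewrite invgM.
  apply: (@essentially_coherent_conjV _ _ y^-1); move: e; congr essentially_coherent.
    by rewrite conjgE !mulgA mulVg mul1g.
  by rewrite conjgE mulgV mulg1 invgK.
case: s t => [] [] /= h hd.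
- apply/flip/(@essentially_coherent_signed false true)/coherent_essentially.
  exact: coherent_mul.
- exact: flip.
- by apply: (@essentially_coherent_signed false true); rewrite invgK in hd.
- exact/coherent_essentially/coherent_mul.
Qed.

Lemma nielsen_essentially_coherent u v :
  nielsen_pair u v -> essentially_coherent u v.
Proof.
elim=> [|{}u {}v _|{}u {}v _|{}u {}v _|{}u {}v g _].
- exact/coherent_essentially/(coherent_base false false).
- exact: essentially_coherent_swap.
- exact: essentially_coherent_inv.
- exact: essentially_coherent_mul.
- exact: essentially_coherent_conj.
Qed.

Lemma all_fg_cat (T : choiceType) (P : pred (letter T)) (s t : seq (letter T)) :
  all P s -> all P t -> all P (fg_cat s t).
Proof.
move=> Ps Pt; elim: s Ps => [|l s IH] //= /andP[Pl /IH].
case: (fg_cat s t) => [|m r] /=; first by rewrite Pl.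
by case: ifP => _ /andP[Pm Pr] //=; rewrite Pl Pm.
Qed.

Lemma coherent_monotone u v : coherent_pair u v -> exists sg : 'I_2 -> bool,
  all (fun l => l.2 == sg l.1) (fg_word u) /\
  all (fun l => l.2 == sg l.1) (fg_word v).
Proof.
elim=> [s t|{}u {}v _ [sg [hu hv]]|{}u {}v _ [sg [hu hv]]].
- by exists (fun i => if i == ord0 then s else t); case: s; case: t.
- by exists sg.
- by exists sg; split=> //; apply: all_fg_cat.
Qed.

Lemma exp_normV x : exp_norm x^-1 = exp_norm x.
Proof. by rewrite /exp_norm /exp_a /exp_b !exp_sumV !abszN. Qed.

Lemma exp_normJ x g : exp_norm (x ^ g) = exp_norm x.
Proof. by rewrite /exp_norm /exp_a /exp_b !exp_sumJ. Qed.

(** Sign-coherent words have length equal to the absolute exponent sum, and the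
    latter is insensitive to the inversions and the conjugation which make the
    pair coherent. *)
Lemma generates_monotone_conj u v : generates u v -> exists g,
  fg_length (u ^ g) = exp_norm u /\ fg_length (v ^ g) = exp_norm v.
Proof.
move=> /generating_nielsen_pair/nielsen_essentially_coherent[s [t [g h]]].
have [sg [hu hv]] := coherent_monotone h; exists g.
have E r x : all (fun l => l.2 == sg l.1) (fg_word (signed r x ^ g)) ->
    fg_length (x ^ g) = exp_norm x.
  move/exp_norm_monotone; rewrite exp_normJ.
  by case: r => /=; rewrite ?exp_normV ?conjVg ?fg_lengthV => ->.
by split; apply: E; [exact: hu|exact: hv].
Qed.

End Coherent.

(** * The norm of an outer automorphism *)

Section OuterNorm.
Local Open Scope group_scope.
Local Open Scope classical_set_scope.
Implicit Types (phi psi : Aut F2) (Phi : Out F2).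

Lemma set_minE (A : set nat) m : A m -> (forall k, A k -> m <= k) -> set_min A = m.
Proof.
move=> Am lb; rewrite /set_min; case: xgetP => [k -> [Ak kb]|/(_ m) []//].
by apply/eqP; rewrite eqn_leq kb // lb.
Qed.

Lemma set_maxE (A : set nat) m : A m -> (forall k, A k -> k <= m) -> set_max A = m.
Proof.
move=> Am ub; rewrite /set_max; case: xgetP => [k -> [Ak kb]|/(_ m) []//].
by apply/eqP; rewrite eqn_leq kb // ub.
Qed.

Lemma aut_generates phi : generates (phi gen_a) (phi gen_b).
Proof.
move=> x; exists (aut_inv_fun phi x); rewrite -[x in RHS](aut_invP phi).2.
apply: (fg_hom_ext (@fg_eval_morph _ _ _) (@gmulfM _ _ phi)).
by elim/I2P; rewrite fg_eval_gen.
Qed.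

Definition matrix_norm phi := exp_norm (phi gen_a) + exp_norm (phi gen_b).

(** [exp_norm_le] bounds every representative from below, and
    [generates_monotone_conj] provides one attaining the bound. *)
Lemma out_norm_matrix phi : out_norm (out_class phi) = matrix_norm phi.
Proof.
have E g x : (phi * inner g) x = phi x ^ g by [].
apply: set_minE => [|_ [_ /inn_cosetP[g ->] <-]].
  have [g [ha hb]] := generates_monotone_conj (aut_generates phi).
  exists (phi * inner g); first by apply/inn_cosetP; exists g.
  by rewrite /aut_norm !E ha hb.
by rewrite /matrix_norm /aut_norm -(exp_normJ (phi gen_a) g)
           -(exp_normJ (phi gen_b) g) leq_add // exp_norm_le.
Qed.

Lemma matrix_normV phi : matrix_norm phi^-1 = matrix_norm phi.
Proof.
have entry i x := exp_sum_morph i (@gmulfM _ _ phi^-1) x.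
have K x : phi^-1 (phi x) = x by apply: (aut_invP phi).1.
have := entry ord_max (phi gen_b); have := entry ord0 (phi gen_b).
have := entry ord_max (phi gen_a); have := entry ord0 (phi gen_a).
rewrite !K !exp_sum_gen /= => /esym e1 /esym e2 /esym e3 /esym e4.
apply: (adjugate_norm e1 e2 e3 e4).
Qed.

Lemma out_normV Phi : out_norm Phi^-1 = out_norm Phi.
Proof.
have [phi ->] := out_classP Phi.
by rewrite -[_^-1]/(out_inv _) out_classV !out_norm_matrix matrix_normV.
Qed.

Definition transvection_fun (x : F2) : F2 -> F2 :=
  fg_eval (pair_fun gen_a (gen_b * x)).

Lemma transvection_K (x y : F2) (k := transvection_fun y) :
  k x = x -> y * x = 1 -> cancel (transvection_fun x) k.
Proof.
move=> kx yx; have kM : {morph k : u v / u * v} by exact: fg_eval_morph.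
have fM : {morph transvection_fun x : u v / u * v} by exact: fg_eval_morph.
apply: (@fg_hom_ext _ _ (k \o transvection_fun x) id) => [u v|//|] /=.
  by rewrite fM kM.
elim/I2P; rewrite /transvection_fun fg_eval_gen /=; first exact: fg_eval_gen.
by rewrite kM kx /k /transvection_fun fg_eval_gen /= -mulgA yx mulg1.
Qed.

Lemma transvection_fun_expg x n :
  transvection_fun x (gen_a ^+ n) = gen_a ^+ n.
Proof.
have fM : {morph transvection_fun x : u v / u * v} by exact: fg_eval_morph.
elim: n => [|n IH]; first by rewrite (morph_one fM).
by rewrite expgS fM IH /transvection_fun fg_eval_gen.
Qed.

Lemma exists_out_norm n : 1 < n -> exists Phi, out_norm Phi = n.
Proof.
case: n => [|[|n]] // _; pose x : F2 := gen_a ^+ n.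
have fM y : {morph transvection_fun y : u v / u * v} by exact: fg_eval_morph.
have fx y : transvection_fun y x = x by exact: transvection_fun_expg.
have fxV y : transvection_fun y x^-1 = x^-1 by rewrite (morph_inv (fM y)) fx.
exists (out_class (mk_aut (fM x) (transvection_K (fx _) (mulVg x))
                                 (transvection_K (fxV _) (mulgV x)))).
rewrite out_norm_matrix /matrix_norm /= /transvection_fun !fg_eval_gen /=.
rewrite /exp_norm /exp_a /exp_b !exp_sumM !exp_sum_gen /=.
have X i m : exp_sum i (gen_a ^+ m) = (exp_sum i gen_a *+ m)%R.
  elim: m => [|m IH]; first by rewrite exp_sum1.
  by rewrite expgS exp_sumM IH GRing.mulrS.
by rewrite !X !exp_sum_gen /= GRing.mul0rn natz; lia.
Qed.

Lemma beta2E n : n <> 1%N -> beta2 n = n.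
Proof.
case: n => [|n] n1.
  (* A maximum, if there is one, is a norm bounded by 0; otherwise the default
     value 0 applies. *)
  rewrite /beta2 /set_max; case: xgetP => // m -> [[Phi le <-] _].
  by apply/eqP; rewrite -leqn0 out_normV.
have [|Phi e] := @exists_out_norm n.+1; first by case: n n1.
apply: set_maxE; first by exists Phi; rewrite ?out_normV //= e.
by move=> _ [Psi le <-]; rewrite out_normV.
Qed.

End OuterNorm.

(* For n = 1 there is no class of norm at most 1, so that beta2 1 = 0.         *)
Theorem theorem3p7 :
  (forall Phi : Out F2, out_norm (Phi^-1)%g = out_norm Phi) /\
  (forall n : nat, n <> 1 -> beta2 n = n).
Proof. by split; [exact: out_normV | exact: beta2E]. Qed.
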